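(* (i) Let $L,M,N>0$ and let $R(M,L,N)\subset\mathbb C$ be the rectangle $\{x+iy: M\le x\le M+L,\ |y|\le N\}$. Then $R(M,L,N)\in A_{\pi/2}^2$ if $$N\le\frac{2M^{3/2}}{\sqrt{L+24M}}.$$ (ii) Let $0<M<L$ and $t>0$, and let $T(M,L,t)\subset\mathbb C$ be the trapezoid $\{x+iy: M\le x\le L,\ |y|\le tx\}$. Then $T(M,L,t)\in A_{\pi/2}^2$ if $t<\sqrt2-1$ and $$L\le M\left(\frac{t^2+t^{-2}-4+(t^{-1}-t)\sqrt{t^2+t^{-2}-6}}{2}\right)^{1/2}.$$ Moreover, the right-hand side of this last inequality equals $Mt^{-1}(1+o(t))$ as $t\to0$.
   Context: $\mathbb C^*=\mathbb C\setminus\{0\}$; $\arg(z)$ takes values in $(-\pi,\pi]$; $x,y$ denote real numbers. $A_{\pi/2}^2$ is the set of all subsets $S\subset\mathbb C^*$ such that for all $a,b,c,d\in S$ the map $z\mapsto\frac{az+b}{cz+d}$ maps $\{z\in\mathbb C^*:|\arg(z)|\le\pi/2\}$ into $\{u\in\mathbb C^*:|\arg(u)|\le\pi/2\}$ (in particular $az+b\ne0$ and $cz+d\ne0$ for all such $z$). *)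

(* Defs.v *)
From Stdlib Require Import Reals Lra Lia Psatz.
From Coquelicot Require Import Coquelicot.
Open Scope R_scope.

(** Principal argument, with values in (-PI, PI]; see [arg_spec].  The value at
    [z = 0] is irrelevant. *)
Definition arg (z : C) : R :=
  if Rle_dec 0 (Im z) then acos (Re z / Cmod z) else - acos (Re z / Cmod z).

Lemma arg_spec (z : C) : z <> RtoC 0 ->
  - PI < arg z <= PI /\
  Re z = Cmod z * cos (arg z) /\ Im z = Cmod z * sin (arg z).
Proof.
intros Hz.
assert (Hm : 0 < Cmod z) by (apply Cmod_gt_0; exact Hz).
assert (H2 : Cmod z ^ 2 = Re z ^ 2 + Im z ^ 2) by apply Cmod2_alt.
set (q := Re z / Cmod z).
assert (Hq : Re z = Cmod z * q) by (unfold q; field; lra).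
assert (Hs : Im z ^ 2 = Cmod z ^ 2 * (1 - q ^ 2)) by (rewrite Hq in H2; nra).
assert (Hp : 0 < Cmod z ^ 2) by nra.
assert (Hq1 : 0 <= 1 - q ^ 2) by (pose proof (pow2_ge_0 (Im z)); nra).
assert (Hq2 : -1 <= q <= 1) by nra.
assert (Hsin : sqrt (1 - q²) = Rabs (Im z) / Cmod z).
{ replace (1 - q²) with ((Rabs (Im z) / Cmod z) ^ 2).
  - apply sqrt_pow2. apply Rdiv_le_0_compat; [apply Rabs_pos | exact Hm].
  - unfold Rdiv, Rsqr. rewrite Rpow_mult_distr, pow2_abs, Hs. field. apply Rgt_not_eq; exact Hm. }
pose proof (acos_bound q) as Hb.
unfold arg; fold q.
destruct (Rle_dec 0 (Im z)) as [Hi | Hi].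
- split; [pose proof PI_RGT_0; lra |].
  rewrite cos_acos, sin_acos, Hsin, Rabs_pos_eq by lra.
  split; [exact Hq | field; lra].
- assert (Hi2 : 0 < Im z ^ 2) by nra.
  assert (Hq0 : 0 < 1 - q ^ 2) by nra.
  assert (Hq3 : -1 < q < 1) by nra.
  pose proof (acos_bound_lt q Hq3).
  split; [lra |].
  rewrite cos_neg, sin_neg, cos_acos, sin_acos, Hsin, Rabs_left by lra.
  split; [exact Hq | field; lra].
Qed.

Definition sector_half_pi (z : C) : Prop :=
  z <> RtoC 0 /\ Rabs (arg z) <= PI / 2.

(** [A2_half_pi S] says that [S] belongs to the family $A_{\pi/2}^2$.
    Since [Cdiv] is total, the non-vanishing of the denominator is required
    explicitly; that of the numerator then follows from the image lying in
    [sector_half_pi]. *)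
Definition A2_half_pi (S : C -> Prop) : Prop :=
  (forall s : C, S s -> s <> RtoC 0) /\
  (forall a b c d : C, S a -> S b -> S c -> S d ->
   forall z : C, sector_half_pi z ->
     (c * z + d)%C <> RtoC 0 /\
     sector_half_pi ((a * z + b) / (c * z + d))%C).

Definition rectangle (M L N : R) (z : C) : Prop :=
  M <= Re z <= M + L /\ Rabs (Im z) <= N.

Definition trapezoid (M L t : R) (z : C) : Prop :=
  M <= Re z <= L /\ Rabs (Im z) <= t * Re z.

Definition trapezoid_bound (M t : R) : R :=
  M * sqrt ((t ^ 2 + / t ^ 2 - 4 + (/ t - t) * sqrt (t ^ 2 + / t ^ 2 - 6)) / 2).

(* Main.v *)
(** A nonzero [z] lies in the sector iff [0 <= Re z], so [S] is in the family as
    soon as, for all [a], [b], [c], [d] in [S], [Re (a * conj c) > 0] and the real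
    part of [(a z + b) * conj (c z + d)] is nonnegative on the right half plane;
    the first condition lets us check the second on the imaginary axis only,
    where it bounds the angle between two points of [i y S + S] by [PI / 2].

    For a rectangle, [i y S + S] is again a rectangle and only two of its
    vertices matter; the condition is a quadratic inequality in [y] whose
    discriminant is controlled by the bound on [N].

    For the trapezoid, put [k = 1 / t - t].  The bound on [L / M] is the larger
    root of [r + 1 / r = k], so the hypothesis says [L / M + M / L <= k], which is
    again a discriminant condition.  In this form the bound is
    [M * (k + sqrt (k ^ 2 - 4)) / 2], whence its asymptotics. *)
Require Import Defs.
From Stdlib Require Import Reals Lra.
From Coquelicot Require Import Coquelicot.
Open Scope R_scope.

(** * Sector membership and reduction to the imaginary axis *)

Lemma sector_half_pi_Re (z : C) :
  sector_half_pi z <-> z <> RtoC 0 /\ 0 <= Re z.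
Proof.
unfold sector_half_pi; split; intros [Hz H]; split; auto;
  destruct (arg_spec z Hz) as [Harg [HRe _]];
  pose proof (proj1 (Cmod_gt_0 z) Hz) as Hm.
- apply Rabs_le_between in H.
  rewrite HRe; apply Rmult_le_pos; [lra | apply cos_ge_0; lra].
- assert (Hcos : 0 <= cos (arg z)) by (rewrite HRe in H; nra).
  apply Rabs_le_between; split; apply Rnot_lt_le; intros Hlt.
  + assert (cos (- arg z) < 0) by (apply cos_lt_0; lra).
    rewrite cos_neg in *; lra.
  + assert (cos (arg z) < 0) by (apply cos_lt_0; lra); lra.
Qed.

Lemma Re_Cdiv (u v : C) : v <> RtoC 0 ->
  Re (u / v) = (Re u * Re v + Im u * Im v) / (Re v ^ 2 + Im v ^ 2).
Proof.
intros Hv.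
assert (Hm : Re v ^ 2 + Im v ^ 2 <> 0).
{ rewrite <- Cmod2_alt; apply pow_nonzero.
  apply Rgt_not_eq, Cmod_gt_0, Hv. }
destruct u as [u1 u2], v as [v1 v2]; simpl in *; field; lra.
Qed.

(* The inner product of [b + i y a] and [d + i y c]. *)
Definition axis_form (a b c d : C) (y : R) : R :=
  (Re b - y * Im a) * (Re d - y * Im c) + (Im b + y * Re a) * (Im d + y * Re c).

(** The inner product of [a z + b] with [a] is [|a|^2 Re z + Re (a conj b)], which is positive. *)
Lemma affine_neq_0 (a b z : C) :
  0 < Re a * Re b + Im a * Im b -> 0 <= Re z -> 0 < Re a * Re a + Im a * Im a ->
  (a * z + b)%C <> RtoC 0.
Proof.
intros Hab Hz Ha E.
assert (E1 := f_equal Re E); assert (E2 := f_equal Im E).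
destruct a as [a1 a2], b as [b1 b2], z as [x y]; simpl in *.
assert (Hs : a1 * (a1 * x - a2 * y + b1) + a2 * (a1 * y + a2 * x + b2) = 0)
  by (rewrite E1, E2; ring).
nra.
Qed.

Lemma A2_half_pi_of_axis (S : C -> Prop) :
  (forall a b, S a -> S b -> 0 < Re a * Re b + Im a * Im b) ->
  (forall a b c d y, S a -> S b -> S c -> S d -> 0 <= axis_form a b c d y) ->
  A2_half_pi S.
Proof.
intros Hpos Haxis; split.
- intros s Hs E; specialize (Hpos s s Hs Hs); rewrite E in Hpos; simpl in Hpos; lra.
- intros a b c d Sa Sb Sc Sd z [Hz HRe]%sector_half_pi_Re.
  assert (Hn : (a * z + b)%C <> RtoC 0) by (apply affine_neq_0; auto).
  assert (Hd : (c * z + d)%C <> RtoC 0) by (apply affine_neq_0; auto).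
  split; [exact Hd |].
  apply sector_half_pi_Re; split.
  + intros E; apply Hn.
    replace (a * z + b)%C with ((a * z + b) / (c * z + d) * (c * z + d))%C
      by (field; exact Hd).
    rewrite E; ring.
  + rewrite Re_Cdiv by exact Hd.
    apply Rmult_le_pos.
    (* With [x = Re z], the numerator is [axis_form] at [Im z] plus [x^2 Re (a conj c) + x (Re (a
       conj d) + Re (b conj c))]: the mixed terms in [x y] cancel. *)
    * pose proof (Haxis a b c d (Im z) Sa Sb Sc Sd) as HF.
      pose proof (Hpos a c Sa Sc) as Hac.
      pose proof (Hpos a d Sa Sd) as Had.
      pose proof (Hpos b c Sb Sc) as Hbc.
      unfold axis_form in HF.
      destruct a as [a1 a2], b as [b1 b2], c as [c1 c2], d as [d1 d2], z as [x y].
      simpl in *.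
      pose proof (Rmult_le_pos _ _ (Rlt_le _ _ Hac) (Rmult_le_pos _ _ HRe HRe)).
      pose proof (Rmult_le_pos _ _ (Rlt_le _ _ Had) HRe).
      pose proof (Rmult_le_pos _ _ (Rlt_le _ _ Hbc) HRe).
      lra.
    * rewrite <- Cmod2_alt; apply Rlt_le, Rinv_0_lt_compat, pow_lt, Cmod_gt_0, Hd.
Qed.

(** * Two elementary inequalities *)

Lemma quadratic_nonneg (p q r y : R) :
  0 < p -> r ^ 2 <= 4 * p * q -> 0 <= p * y ^ 2 - r * y + q.
Proof.
intros Hp Hr.
assert (0 <= 4 * p * (p * y ^ 2 - r * y + q)).
{ pose proof (pow2_ge_0 (2 * p * y - r)); nra. }
nra.
Qed.

(** A negative product has one negative factor, at least [l], and one positive factor, at most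
    [h]. *)
Lemma Rmult_ge_opposite_ends (l h u v : R) :
  l <= 0 <= h -> l <= u <= h -> l <= v <= h -> l * h <= u * v.
Proof.
intros Hl Hu Hv.
destruct (Rle_dec 0 u), (Rle_dec 0 v); nra.
Qed.

(** * Rectangles *)

Lemma rectangle_discriminant (M L N : R) :
  0 < M -> 0 < L -> N ^ 2 * (L + 24 * M) <= 4 * M ^ 3 ->
  (N * (L + 2 * M)) ^ 2 <= 4 * (M ^ 2 - N ^ 2) * (M * (M + L) + N ^ 2).
Proof.
intros HM HL HN.
pose proof (pow2_ge_0 N) as Hs; set (s := N ^ 2) in *.
assert (Hs6 : 6 * s <= M ^ 2).
{ apply Rmult_le_reg_r with M; nra. }
replace ((N * (L + 2 * M)) ^ 2) with (s * (L + 2 * M) ^ 2) by (unfold s; ring).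
(* The difference of the two sides of the goal is that of [H1] plus the surplus in [H2]. *)
assert (H1 : s * (L + 24 * M) * (M + L) <= 4 * M ^ 3 * (M + L))
  by (apply Rmult_le_compat_r; lra).
assert (H2 : 0 <= s * (17 * L * M + 20 * M ^ 2 - 4 * s)).
{ apply Rmult_le_pos; [lra |]. pose proof (Rmult_lt_0_compat _ _ HL HM). lra. }
lra.
Qed.

Section Rectangle.

Variables M L N : R.
Hypotheses (HM : 0 < M) (HL : 0 < L) (HN : 0 < N).
Hypothesis HNM : N ^ 2 * (L + 24 * M) <= 4 * M ^ 3.

Lemma rectangle_height_lt : N < M.
Proof using HM HL HN HNM.
apply Rnot_le_lt; intros H.
assert (M ^ 2 <= N ^ 2) by (apply pow_incr; lra).
assert (M ^ 2 * (L + 24 * M) <= N ^ 2 * (L + 24 * M))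
  by (apply Rmult_le_compat_r; lra).
pose proof (pow_lt M 3 HM); pose proof (pow_lt M 2 HM); nra.
Qed.

Lemma rectangle_Re_mul_conj (a b : C) :
  rectangle M L N a -> rectangle M L N b -> 0 < Re a * Re b + Im a * Im b.
Proof using HM HL HN HNM.
unfold rectangle; intros [Ha1 Ha2%Rabs_le_between] [Hb1 Hb2%Rabs_le_between].
pose proof rectangle_height_lt.
assert (M * M <= Re a * Re b) by (apply Rmult_le_compat; lra).
assert (- N * N <= Im a * Im b) by (apply Rmult_ge_opposite_ends; nra).
nra.
Qed.

Lemma rectangle_axis_pos (a b c d : C) (y : R) : 0 <= y ->
  rectangle M L N a -> rectangle M L N b -> rectangle M L N c -> rectangle M L N d ->
  0 <= axis_form a b c d y.
Proof using HM HL HN HNM.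
unfold rectangle, axis_form.
intros Hy [Ha1 Ha2%Rabs_le_between] [Hb1 Hb2%Rabs_le_between]
  [Hc1 Hc2%Rabs_le_between] [Hd1 Hd2%Rabs_le_between].
pose proof rectangle_height_lt as HNM'.
pose proof (rectangle_discriminant M L N HM HL HNM) as Hdisc.
assert (Hbox : forall p q : C,
  M <= Re p <= M + L -> - N <= Im p <= N -> M <= Re q <= M + L -> - N <= Im q <= N ->
  M - y * N <= Re q - y * Im p <= M + L + y * N /\
  y * M - N <= Im q + y * Re p <= y * (M + L) + N) by (intros; nra).
destruct (Hbox a b) as [Hu1 Hu2]; auto.
destruct (Hbox c d) as [Hv1 Hv2]; auto.
clear Hbox.
set (u1 := Re b - y * Im a) in *; set (u2 := Im b + y * Re a) in *.
set (v1 := Re d - y * Im c) in *; set (v2 := Im d + y * Re c) in *.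
(* The cases record which lower ends of the coordinate ranges are negative. A coordinate with
   negative lower end is bounded by the product of opposite ends, the other by the square of its
   lower end; the two resulting quadratics in [y] have the same discriminant. Both ends negative
   would force [y > M / N > 1] and [y < N / M < 1]. *)
destruct (Rle_dec 0 (M - y * N)) as [Hx | Hx];
  destruct (Rle_dec 0 (y * M - N)) as [Hy' | Hy'].
- apply Rplus_le_le_0_compat; apply Rmult_le_pos; lra.
- assert (H1 : (M - y * N) * (M - y * N) <= u1 * v1)
    by (apply Rmult_le_compat; lra).
  assert (H2 : (y * M - N) * (y * (M + L) + N) <= u2 * v2)
    by (apply Rmult_ge_opposite_ends; nra).
  assert (Hq : 0 <= (M * (M + L) + N ^ 2) * y ^ 2 - N * (L + 2 * M) * y + (M ^ 2 - N ^ 2))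
    by (apply quadratic_nonneg; nra).
  lra.
- assert (H1 : (M - y * N) * (M + L + y * N) <= u1 * v1)
    by (apply Rmult_ge_opposite_ends; nra).
  assert (H2 : (y * M - N) * (y * M - N) <= u2 * v2)
    by (apply Rmult_le_compat; lra).
  assert (Hq : 0 <= (M ^ 2 - N ^ 2) * y ^ 2 - N * (L + 2 * M) * y + (M * (M + L) + N ^ 2))
    by (apply quadratic_nonneg; nra).
  lra.
- exfalso; nra.
Qed.

Lemma rectangle_conj (z : C) : rectangle M L N z -> rectangle M L N (Cconj z).
Proof using Type.
unfold rectangle; destruct z as [x y]; simpl; rewrite Rabs_Ropp; auto.
Qed.

Lemma rectangle_A2 : A2_half_pi (rectangle M L N).
Proof using HM HL HN HNM.
apply A2_half_pi_of_axis; [exact rectangle_Re_mul_conj |].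
intros a b c d y Ha Hb Hc Hd.
destruct (Rle_dec 0 y) as [Hy | Hy]; [apply rectangle_axis_pos; auto |].
(* Conjugating all four points changes [y] into [- y]. *)
replace (axis_form a b c d y)
  with (axis_form (Cconj a) (Cconj b) (Cconj c) (Cconj d) (- y))
  by (unfold axis_form, Re, Im; simpl; ring).
apply rectangle_axis_pos; auto using rectangle_conj; lra.
Qed.

End Rectangle.

Lemma rectangle_height_sq (M L N : R) : 0 < M -> 0 < L -> 0 < N ->
  N <= 2 * Rpower M (3 / 2) / sqrt (L + 24 * M) ->
  N ^ 2 * (L + 24 * M) <= 4 * M ^ 3.
Proof.
intros HM HL HN H.
assert (Hs : 0 < sqrt (L + 24 * M)) by (apply sqrt_lt_R0; lra).
apply Rle_div_r in H; [| exact Hs].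
assert (HR : Rpower M (3 / 2) ^ 2 = M ^ 3).
{ rewrite <- (Rpower_pow 3 M), <- (Rpower_pow 2 (Rpower M (3 / 2))) by
    (assumption || apply exp_pos).
  rewrite Rpower_mult; f_equal; simpl; field. }
rewrite <- (pow2_sqrt (L + 24 * M)), <- HR by lra.
replace (N ^ 2 * sqrt (L + 24 * M) ^ 2) with ((N * sqrt (L + 24 * M)) ^ 2) by ring.
replace (4 * Rpower M (3 / 2) ^ 2) with ((2 * Rpower M (3 / 2)) ^ 2) by ring.
apply pow_incr; split; [apply Rlt_le, Rmult_lt_0_compat |]; assumption.
Qed.

(** * Trapezoids *)

(* With [p = a d], [q = b c] this maximises [(p + q) ^ 2 / (p q)] at the extreme
   ratio [p / q = L ^ 2 / M ^ 2]. *)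
Lemma cross_product_ratio (M L a b c d : R) : 0 < M ->
  M <= a <= L -> M <= b <= L -> M <= c <= L -> M <= d <= L ->
  (M * L * (a * d + b * c)) ^ 2 <= (L ^ 2 + M ^ 2) ^ 2 * (a * c * (b * d)).
Proof.
intros HM Ha Hb Hc Hd.
assert (Hprod : forall u v w x, M <= u <= L -> M <= v <= L -> M <= w <= L -> M <= x <= L ->
  0 <= u * v * L ^ 2 - w * x * M ^ 2).
{ intros u v w x Hu Hv Hw Hx.
  assert (M * w <= u * L) by (apply Rmult_le_compat; lra).
  assert (M * x <= v * L) by (apply Rmult_le_compat; lra).
  assert ((M * w) * (M * x) <= (u * L) * (v * L))
    by (apply Rmult_le_compat; try assumption; apply Rmult_le_pos; lra).
  lra. }
assert (H1 := Hprod a d b c Ha Hd Hb Hc).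
assert (H2 := Hprod b c a d Hb Hc Ha Hd).
pose proof (Rmult_le_pos _ _ H1 H2).
lra.
Qed.

Lemma slope_product (t a1 a2 b1 b2 : R) : 0 <= a1 -> 0 <= b1 ->
  Rabs a2 <= t * a1 -> Rabs b2 <= t * b1 -> (1 - t ^ 2) * (a1 * b1) <= a1 * b1 + a2 * b2.
Proof.
intros Ha Hb Ha2 Hb2.
assert (Rabs (a2 * b2) <= (t * a1) * (t * b1)).
{ rewrite Rabs_mult; apply Rmult_le_compat; auto using Rabs_pos. }
assert (- Rabs (a2 * b2) <= a2 * b2) by (pose proof (Rabs_maj2 (a2 * b2)); lra).
lra.
Qed.

Lemma trapezoid_A2 (M L t : R) : 0 < M -> 0 < t < 1 ->
  t * (L ^ 2 + M ^ 2) <= (1 - t ^ 2) * (M * L) -> A2_half_pi (trapezoid M L t).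
Proof.
intros HM Ht Hk.
assert (Ht2 : 0 < 1 - t ^ 2) by nra.
apply A2_half_pi_of_axis; unfold trapezoid.
- intros a b [Ha Ha2] [Hb Hb2].
  assert (0 < Re a * Re b) by (apply Rmult_lt_0_compat; lra).
  pose proof (slope_product t (Re a) (Im a) (Re b) (Im b)).
  nra.
- intros [a1 a2] [b1 b2] [c1 c2] [d1 d2] y [Ha Ha2] [Hb Hb2] [Hc Hc2] [Hd Hd2].
  unfold axis_form; simpl in *.
  assert (HL : 0 < L) by lra.
  assert (HML : 0 < M * L) by (apply Rmult_lt_0_compat; lra).
  assert (Hac : 0 < a1 * c1) by (apply Rmult_lt_0_compat; lra).
  assert (Hbd : 0 < b1 * d1) by (apply Rmult_lt_0_compat; lra).
  assert (Hp := slope_product t a1 a2 c1 c2 ltac:(lra) ltac:(lra) Ha2 Hc2).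
  assert (Hq := slope_product t b1 b2 d1 d2 ltac:(lra) ltac:(lra) Hb2 Hd2).
  (* [- r] is the coefficient of [y] in the axis form; bounding its four terms by the slope
     condition gives [|r| <= 2 t m]. *)
  set (r := a2 * d1 - a1 * d2 + c2 * b1 - c1 * b2).
  set (m := a1 * d1 + b1 * c1).
  assert (Hr : r ^ 2 <= (2 * t * m) ^ 2).
  { apply Rabs_le_between in Ha2, Hb2, Hc2, Hd2.
    unfold r, m; apply pow_maj_Rabs, Rabs_le_between; split; nra. }
  assert (Hm : t ^ 2 * m ^ 2 <= (1 - t ^ 2) ^ 2 * (a1 * c1 * (b1 * d1))).
  { apply Rmult_le_reg_l with ((M * L) ^ 2); [apply pow_lt, HML |].
    pose proof (cross_product_ratio M L a1 b1 c1 d1 HM Ha Hb Hc Hd) as Hx; fold m in Hx.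
    assert (Hk2 : (t * (L ^ 2 + M ^ 2)) ^ 2 <= ((1 - t ^ 2) * (M * L)) ^ 2).
    { apply pow_incr; split; [| exact Hk].
      pose proof (pow2_ge_0 L); pose proof (pow2_ge_0 M); nra. }
    pose proof (Rmult_lt_0_compat _ _ Hac Hbd) as Hacbd.
    pose proof (Rmult_le_compat_l _ _ _ (pow2_ge_0 t) Hx).
    pose proof (Rmult_le_compat_r _ _ _ (Rlt_le _ _ Hacbd) Hk2).
    lra. }
  assert (Hpq : ((1 - t ^ 2) * (a1 * c1)) * ((1 - t ^ 2) * (b1 * d1))
    <= (a1 * c1 + a2 * c2) * (b1 * d1 + b2 * d2)).
  { apply Rmult_le_compat; try assumption; apply Rmult_le_pos; lra. }
  assert (Hquad : 0 <= (a1 * c1 + a2 * c2) * y ^ 2 - r * y + (b1 * d1 + b2 * d2)).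
  { apply quadratic_nonneg; [| lra].
    pose proof (Rmult_lt_0_compat _ _ Ht2 Hac); lra. }
  unfold r in Hquad; lra.
Qed.

(** * The trapezoid bound and its asymptotics *)

(** [sqrt 2 - 1] is the positive root of [1 - t^2 = 2 t]. *)
Lemma inv_sub_gt_2 (t : R) : 0 < t < sqrt 2 - 1 -> 2 < / t - t.
Proof.
intros Ht.
assert (H2 : sqrt 2 ^ 2 = 2) by (apply pow2_sqrt; lra).
apply Rmult_lt_reg_l with t; [lra |].
replace (t * (/ t - t)) with (1 - t ^ 2) by (field; lra).
nra.
Qed.

Lemma trapezoid_bound_root (M t : R) : 0 < t < sqrt 2 - 1 ->
  trapezoid_bound M t = M * ((/ t - t + sqrt ((/ t - t) ^ 2 - 4)) / 2).
Proof.
intros Ht.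
pose proof (inv_sub_gt_2 t Ht) as Hk.
assert (Ht2 : t ^ 2 + / t ^ 2 = (/ t - t) ^ 2 + 2) by (field; lra).
unfold trapezoid_bound; rewrite Ht2; f_equal.
set (k := / t - t) in *.
replace (k ^ 2 + 2 - 6) with (k ^ 2 - 4) by ring.
assert (Hw : sqrt (k ^ 2 - 4) ^ 2 = k ^ 2 - 4) by (apply pow2_sqrt; nra).
pose proof (sqrt_pos (k ^ 2 - 4)).
set (w := sqrt (k ^ 2 - 4)) in *.
replace ((k ^ 2 + 2 - 4 + k * w) / 2) with (((k + w) / 2) ^ 2) by nra.
apply sqrt_pow2; lra.
Qed.

Lemma trapezoid_length (M L t : R) : 0 < M -> M < L -> 0 < t < sqrt 2 - 1 ->
  L <= trapezoid_bound M t -> t * (L ^ 2 + M ^ 2) <= (1 - t ^ 2) * (M * L).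
Proof.
intros HM HL Ht; rewrite trapezoid_bound_root by exact Ht.
pose proof (inv_sub_gt_2 t Ht) as Hk.
replace (1 - t ^ 2) with (t * (/ t - t)) by (field; lra).
set (k := / t - t) in *.
assert (Hw : sqrt (k ^ 2 - 4) ^ 2 = k ^ 2 - 4) by (apply pow2_sqrt; nra).
pose proof (sqrt_pos (k ^ 2 - 4)).
set (w := sqrt (k ^ 2 - 4)) in *.
intros Hroot.
(* The roots [(k - w) / 2] and [(k + w) / 2] have product 1. Since [(k - 2)^2 <= k^2 - 4], the
   smaller is at most [1 < L / M], so [L / M] lies between them. *)
assert (Hsmall : k - w <= 2) by nra.
assert (H1 : 0 <= L - M * ((k - w) / 2)) by nra.
assert (H2 : 0 <= M * ((k + w) / 2) - L) by lra.
pose proof (Rmult_le_pos _ _ H1 H2).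
rewrite Rmult_assoc; apply Rmult_le_compat_l; [lra |].
replace (M ^ 2) with (M ^ 2 * ((k ^ 2 - w ^ 2) / 4)) by (rewrite Hw; field).
lra.
Qed.

Lemma trapezoid_bound_rel_error (M t : R) : 0 < M -> 0 < t < sqrt 2 - 1 ->
  Rabs (trapezoid_bound M t * t / M - 1) <= 4 * t ^ 2.
Proof.
intros HM Ht; rewrite trapezoid_bound_root by exact Ht.
pose proof (inv_sub_gt_2 t Ht) as Hk.
set (w := sqrt ((/ t - t) ^ 2 - 4)).
assert (Hw : w ^ 2 = (/ t - t) ^ 2 - 4) by (apply pow2_sqrt; nra).
assert (Hw0 : 0 <= w) by apply sqrt_pos.
replace (M * ((/ t - t + w) / 2) * t / M) with ((1 - t ^ 2 + t * w) / 2) by (field; lra).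
assert (Hv : (t * w) ^ 2 = 1 - 6 * t ^ 2 + t ^ 4).
{ rewrite Rpow_mult_distr, Hw; field; lra. }
assert (Hv0 : 0 <= t * w) by (apply Rmult_le_pos; lra).
set (v := t * w) in *.
assert (sqrt 2 < 2) by (pose proof (pow2_sqrt 2 ltac:(lra)); pose proof (sqrt_pos 2); nra).
assert (Ht2 : 0 < t ^ 2 < 1) by nra.
assert (Ht4 : 0 < t ^ 4 < t ^ 2) by (replace (t ^ 4) with (t ^ 2 * t ^ 2) by ring; nra).
(* From [0 <= v <= 1] follows [v >= v^2 >= 1 - 6 t^2], a lower bound on the square root without
   expanding it. *)
assert (Hv1 : v <= 1) by nra.
assert (Hv2 : v ^ 2 <= v) by nra.
apply Rabs_le_between; lra.
Qed.

Theorem proposition4p8 :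
  (forall M L N : R, 0 < M -> 0 < L -> 0 < N ->
     N <= 2 * Rpower M (3 / 2) / sqrt (L + 24 * M) ->
     A2_half_pi (rectangle M L N)) /\
  (forall M L t : R, 0 < M -> M < L -> 0 < t ->
     t < sqrt 2 - 1 ->
     L <= trapezoid_bound M t ->
     A2_half_pi (trapezoid M L t)) /\
  (forall M : R, 0 < M ->
     exists eps : R -> R,
       is_domin (at_right 0) (fun t : R => t) eps /\
       at_right 0 (fun t : R =>
         trapezoid_bound M t = M * / t * (1 + eps t))).
Proof.
assert (Hsqrt2 : 1 < sqrt 2 < 2)
  by (pose proof (pow2_sqrt 2 ltac:(lra)); pose proof (sqrt_pos 2); split; nra).
split; [| split].
- intros M L N HM HL HN H.
  apply rectangle_A2; auto using rectangle_height_sq.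
- intros M L t HM HL Ht0 Ht H.
  apply trapezoid_A2; [assumption | lra |].
  apply trapezoid_length; auto.
- intros M HM.
  (* The witness is the exact relative error, so the equation holds for every [t > 0] and only its
     smallness needs the estimate. *)
  exists (fun t => trapezoid_bound M t * t / M - 1); split.
  + intros e.
    (* Below [sqrt 2 - 1] the estimate applies; below [e / 4] it gives [4 t^2 <= e t]. *)
    assert (Hdelta : 0 < Rmin (sqrt 2 - 1) (e / 4)).
    { pose proof (cond_pos e); apply Rmin_glb_lt; lra. }
    exists (mkposreal _ Hdelta); intros t Hball Ht.
    unfold ball in Hball; simpl in Hball; unfold AbsRing_ball, abs, minus, plus, opp in Hball.
    simpl in Hball.
    rewrite Ropp_0, Rplus_0_r, (Rabs_pos_eq t) in Hball by lra.
    pose proof (Rmin_l (sqrt 2 - 1) (e / 4)); pose proof (Rmin_r (sqrt 2 - 1) (e / 4)).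
    unfold norm; simpl; unfold abs; simpl; rewrite (Rabs_pos_eq t) by lra.
    eapply Rle_trans; [apply trapezoid_bound_rel_error; lra | nra].
  + exists (mkposreal 1 Rlt_0_1); intros t _ Ht.
    field; lra.
Qed.
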